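(* Let $A,B\in \mathbb{B}(\mathscr{H})$ be operators with the polar decompositions $A=U|A|$ and $B=V|B|$, and let $t>0$ and $0<p\leq 1$ be arbitrary. Then $$\big|(U|A|^{p}-V|B|^{p})|A|^{1-p}\big|^{2}\leq (1+t)|A-B|^{2}+\Big(1+\frac{1}{t}\Big)\big||B|^{p}|A|^{1-p}-|B|\big|^2 .$$ Equality holds if and only if $t(A-B)+V(|B|^{p}|A|^{1-p}-|B|)=0$.
   Context: $\mathscr{H}$ is a Hilbert space and $\mathbb{B}(\mathscr{H})$ is the algebra of bounded linear operators on $\mathscr{H}$. For $C\in\mathbb{B}(\mathscr{H})$, $|C|=(C^*C)^{1/2}$; real powers of positive operators are taken via functional calculus. The inequality $\le$ is the usual order on self-adjoint operators. The polar decomposition $C=W|C|$ is the one in which $W$ is the partial isometry with $\ker W=\ker C$, so that $W^*W$ is the orthogonal projection onto the closure of the range of $|C|$. *)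

(* Defs.v *)
From HB Require Import structures.
From mathcomp Require Import all_boot all_order all_algebra complex.
From mathcomp Require Import all_classical all_reals all_analysis.

Set Implicit Arguments.
Unset Strict Implicit.
Unset Printing Implicit Defensive.

Import Order.TTheory GRing.Theory Num.Theory numFieldNormedType.Exports.

Local Open Scope classical_set_scope.
Local Open Scope complex_scope.
Local Open Scope ring_scope.

(* Complex Hilbert spaces. The norm of a normed module over [R[i]] takes its   *)
(* values in [R[i]]; [inner] is linear in its first argument.                  *)
HB.mixin Record CompleteNormedModule_isHilbert (R : realType) H
    of CompleteNormedModule R[i] H := {
  inner : {dot H for Num.conj};
  norm_inner : forall x : H, `|x| ^+ 2 = inner x x
}.

#[short(type="hilbertType")]
HB.structure Definition Hilbert (R : realType) :=
  {H of CompleteNormedModule R[i] H & CompleteNormedModule_isHilbert R H}.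

Record bounded_op (R : realType) (H : hilbertType R) := BoundedOp {
  op_fun :> H -> H;
  op_linear : linear op_fun;
  op_bounded : exists M : R, forall x, `|op_fun x| <= M%:C * `|x|
}.

Notation "''B' ( H )" := (bounded_op H) (format "''B' ( H )") : type_scope.

Section BoundedOpAlgebra.
Context {R : realType} {H : hilbertType R}.
Implicit Types (S T : 'B(H)) (a : R[i]).

HB.instance Definition _ := gen_eqMixin 'B(H).
HB.instance Definition _ := gen_choiceMixin 'B(H).

HB.instance Definition _ T :=
  GRing.isLinear.Build R[i] H H *:%R (op_fun T) (@op_linear R H T).

Lemma opP S T : (forall x, S x = T x) -> S = T.
Proof.
case: S T => [f fl fb] [g gl gb] /= /funext fg.
by case: g / fg gl gb => gl gb; congr BoundedOp; exact: Prop_irrelevance.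
Qed.

Fact op_zero_linear : linear (fun _ : H => 0 : H).
Proof. by move=> a x y; rewrite scaler0 addr0. Qed.

Fact op_zero_bounded : exists M : R, forall x : H, `|0 : H| <= M%:C * `|x|.
Proof. by exists 0 => x; rewrite normr0 mul0r. Qed.

Definition op_zero : 'B(H) := BoundedOp op_zero_linear op_zero_bounded.

Fact op_one_linear : linear (fun x : H => x).
Proof. by []. Qed.

Fact op_one_bounded : exists M : R, forall x : H, `|x| <= M%:C * `|x|.
Proof. by exists 1 => x; rewrite mul1r. Qed.

Definition op_one : 'B(H) := BoundedOp op_one_linear op_one_bounded.

Fact op_opp_linear T : linear (fun x => - T x).
Proof. by move=> a x y; rewrite linearP opprD scalerN. Qed.

Fact op_opp_bounded T : exists M : R, forall x, `|- T x| <= M%:C * `|x|.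
Proof. by have [M TM] := op_bounded T; exists M => x; rewrite normrN. Qed.

Definition op_opp T : 'B(H) := BoundedOp (op_opp_linear T) (op_opp_bounded T).

Fact op_add_linear S T : linear (fun x => S x + T x).
Proof. by move=> a x y; rewrite !linearP scalerDr addrACA. Qed.

Fact op_add_bounded S T : exists M : R, forall x, `|S x + T x| <= M%:C * `|x|.
Proof.
have [[M SM] [N TN]] := (op_bounded S, op_bounded T).
exists (M + N) => x; rewrite (le_trans (ler_normD _ _))//.
by rewrite rmorphD mulrDl lerD.
Qed.

Definition op_add S T : 'B(H) :=
  BoundedOp (op_add_linear S T) (op_add_bounded S T).

Fact op_mul_linear S T : linear (fun x => S (T x)).
Proof. by move=> a x y; rewrite !linearP. Qed.

Fact op_mul_bounded S T : exists M : R, forall x, `|S (T x)| <= M%:C * `|x|.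
Proof.
have [[M SM] [N TN]] := (op_bounded S, op_bounded T).
exists (`|M| * N) => x; rewrite (le_trans (SM _))// rmorphM -mulrA.
rewrite (@le_trans _ _ (`|M|%:C * `|T x|))//.
  by rewrite ler_wpM2r// lecR ler_norm.
by rewrite ler_wpM2l// lecR.
Qed.

Definition op_mul S T : 'B(H) :=
  BoundedOp (op_mul_linear S T) (op_mul_bounded S T).

Fact op_scale_linear a T : linear (fun x => a *: T x).
Proof. by move=> b x y; rewrite linearP scalerDr !scalerA mulrC. Qed.

Fact op_scale_bounded a T :
  exists M : R, forall x, `|a *: T x| <= M%:C * `|x|.
Proof.
have [M TM] := op_bounded T; exists (complex.Re `|a| * M) => x.
by rewrite normrZ rmorphM -mulrA; exact: ler_wpM2l (normr_ge0 a) _ _ _.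
Qed.

Definition op_scale a T : 'B(H) :=
  BoundedOp (op_scale_linear a T) (op_scale_bounded a T).

Fact op_addA : associative op_add.
Proof. by move=> S T X; apply: opP => x; rewrite /= addrA. Qed.

Fact op_addC : commutative op_add.
Proof. by move=> S T; apply: opP => x; rewrite /= addrC. Qed.

Fact op_add0 : left_id op_zero op_add.
Proof. by move=> T; apply: opP => x; rewrite /= add0r. Qed.

Fact op_addN : left_inverse op_zero op_opp op_add.
Proof. by move=> T; apply: opP => x; rewrite /= addNr. Qed.

HB.instance Definition _ :=
  GRing.isZmodule.Build 'B(H) op_addA op_addC op_add0 op_addN.

Fact op_mulA : associative op_mul.
Proof. by move=> S T X; apply: opP. Qed.

Fact op_mul1l : left_id op_one op_mul.
Proof. by move=> T; apply: opP. Qed.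

Fact op_mul1r : right_id op_one op_mul.
Proof. by move=> T; apply: opP. Qed.

Fact op_mulDl : left_distributive op_mul +%R.
Proof. by move=> S T X; apply: opP. Qed.

Fact op_mulDr : right_distributive op_mul +%R.
Proof. by move=> S T X; apply: opP => x; rewrite /= linearD. Qed.

HB.instance Definition _ := GRing.Zmodule_isPzRing.Build 'B(H)
  op_mulA op_mul1l op_mul1r op_mulDl op_mulDr.

Fact op_scaleA a b T : op_scale a (op_scale b T) = op_scale (a * b) T.
Proof. by apply: opP => x; rewrite /= scalerA. Qed.

Fact op_scale1 : left_id 1 op_scale.
Proof. by move=> T; apply: opP => x; rewrite /= scale1r. Qed.

Fact op_scaleDr : right_distributive op_scale +%R.
Proof. by move=> a S T; apply: opP => x; rewrite /= scalerDr. Qed.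

Fact op_scaleDl T : {morph op_scale^~ T : a b / a + b}.
Proof. by move=> a b; apply: opP => x; rewrite /= scalerDl. Qed.

HB.instance Definition _ := GRing.Zmodule_isLmodule.Build R[i] 'B(H)
  op_scaleA op_scale1 op_scaleDr op_scaleDl.

End BoundedOpAlgebra.

Section OperatorTheory.
Context {R : realType} {H : hilbertType R}.
Implicit Types (S T A U : 'B(H)) (f : R -> R).

Definition adjoint T : 'B(H) :=
  xget 0 [set S : 'B(H) | forall x y, inner (T x) y = inner x (S y)].

(* The order of [R[i]] compares imaginary parts by equality, so that           *)
(* [op_le S T] says that [T - S] is positive.                                  *)
Definition op_le S T := forall x, inner (S x) x <= inner (T x) x.

Definition spectrum T : set R[i] :=
  [set z | ~ exists S : 'B(H),
     let Tz := T - z *: (1 : 'B(H)) in S * Tz = 1 /\ Tz * S = 1].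

Definition op_horner (q : {poly R}) T : 'B(H) :=
  \sum_(i < size q) (q`_i)%:C *: T ^+ i.

(* Convergence in the operator norm.                                           *)
Definition op_cvg (T_ : nat -> 'B(H)) T :=
  forall e : R, 0 < e ->
    \forall n \near \oo, forall x, `|T_ n x - T x| <= e%:C * `|x|.

(* Continuous functional calculus of a self-adjoint [T] : [f(T)] is the norm   *)
(* limit of [q_n(T)] for real polynomials [q_n] converging to [f] uniformly on *)
(* the (real) spectrum of [T].                                                 *)
Definition is_fun_calc f T S := exists q : nat -> {poly R},
  (forall e : R, 0 < e -> \forall n \near \oo,
     forall x : R, spectrum T x%:C -> `|(q n).[x] - f x| <= e) /\
  op_cvg (fun n => op_horner (q n) T) S.

Definition fun_calc f T : 'B(H) := xget 0 [set S | is_fun_calc f T S].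

(* As [0 `^ 0 = 1], the power of exponent 0 is the identity.                   *)
Definition op_pow T (s : R) : 'B(H) := fun_calc (fun x => x `^ s) T.

Definition op_abs T : 'B(H) := op_pow (adjoint T * T) 2^-1.

Definition ker_op T : set H := [set x | T x = 0].

Definition partial_isometry U :=
  forall x, (forall y, ker_op U y -> inner x y = 0) -> `|U x| = `|x|.

Definition polar_decomposition A U :=
  [/\ A = U * op_abs A, partial_isometry U & ker_op U = ker_op A].

End OperatorTheory.

Notation "S <=op T" := (op_le S T) (at level 70, no associativity) : ring_scope.

(* Main.v *)
(* Write D = A - B, F = |B|^p |A|^(1-p) - |B| and E = V F. Since               *)
(* |A|^p |A|^(1-p) = |A|, the operator on the left is D - E, and               *)
(*   (1 + t)|D|^2 + (1 + 1/t)|E|^2 - |D - E|^2 = t^-1 |t D + E|^2.             *)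
(* The range of F is orthogonal to ker B = ker V, so V is isometric on it and  *)
(* |E|^2 = |F|^2; this gives both the inequality and its equality case.        *)
(*                                                                             *)
(* The rules |C|^2 = C^* C and T^r T^s = T^(r + s) come from the continuous    *)
(* functional calculus of a symmetric T, which rests on the bound              *)
(* |q(T)| <= sup |q| over the real spectrum for real polynomials q. For that   *)
(* bound, let N = |q(T)|: the operator q(T)^2 - N^2 is not bounded below;      *)
(* factoring q^2 - N^2 over the complex numbers, some T - z with q(z)^2 = N^2  *)
(* is not bounded below, which forces z to be a real point of the spectrum.    *)

Require Import Defs.
From mathcomp Require Import all_boot all_order all_algebra complex.
From mathcomp Require Import all_classical all_reals all_analysis.
From mathcomp Require Import ring lra.

Set Implicit Arguments.
Unset Strict Implicit.
Unset Printing Implicit Defensive.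

Import Order.TTheory GRing.Theory Num.Theory numFieldNormedType.Exports.

Local Open Scope classical_set_scope.
Local Open Scope complex_scope.
Local Open Scope ring_scope.

(** With D, E and F as above, the theorem is a pointwise statement about the vectors u = D x and v =
    E x. The weighted Young inequality |u - v|^2 <= (1 + t)|u|^2 + (1 + 1/t)|v|^2 has the exact
    defect t^-1 |t u + v|^2 ([young_defect]). [polar_difference] identifies the left operator as D -
    E, and [symmetric_kerMB] puts the range of F where V is isometric, so |E x| = |F x|. Both sides
    are symmetric operators, hence determined by their quadratic forms ([symmetric_ext]); they agree
    exactly when t D + E kills every x.

    The bulk of the work is to give meaning to |C| and its powers: [adjoint] and [fun_calc] are
    choices with default 0, so nothing can be said of them before existence is proved. A variational
    argument ([coercive_functional], [coercive_solve]) yields adjoints and inverses, which confines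
    the spectrum of a positive operator to an interval [0, M]. There Bernstein polynomials
    approximate the powers uniformly ([powR_poly_approx]), and [op_horner_bound] turns this into
    convergence in operator norm. Uniqueness and multiplicativity ([is_fun_calc_uniq],
    [is_fun_calcM]) then give [op_powD] and [op_abs_sqr]. *)

(** * Uniform polynomial approximation on [0, 1] *)

Section Bernstein.
Variable R : realType.
Implicit Types (g h : nat -> R) (n : nat) (x c : R).

(* By Pascal's rule, this is \sum_k g k * 'C(n, k) * X^k * (1 - X)^(n - k). *)
Fixpoint bernstein g n : {poly R} :=
  if n is m.+1 then 'X * bernstein (g \o succn) m + (1 - 'X) * bernstein g m
  else (g 0)%:P.

Lemma bernsteinS g n x : (bernstein g n.+1).[x] =
  x * (bernstein (g \o succn) n).[x] + (1 - x) * (bernstein g n).[x].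
Proof. by rewrite /= !hornerE. Qed.

(** On [0, 1] the recursion forms convex combinations, so it preserves order. *)
Lemma bernstein_le g h n x : 0 <= x <= 1 ->
  (forall k, (k <= n)%N -> g k <= h k) ->
  (bernstein g n).[x] <= (bernstein h n).[x].
Proof.
move=> x01; elim: n g h => [|n ih] g h gh; first by rewrite !hornerE gh.
rewrite !bernsteinS lerD// ler_wpM2l//; try lra.
  by apply: ih => k kn; exact: gh.
by apply: ih => k kn; apply/gh/leqW.
Qed.

(** Mean and variance of the binomial law: E (k - c)^2 = (n x - c)^2 + n x (1 - x). The induction
    varies c because shifting k by one replaces c by c - 1. *)
Lemma bernstein_quadratic a b c n x :
  (bernstein (fun k => a + b * (k%:R - c) ^+ 2) n).[x] =
  a + b * ((n%:R * x - c) ^+ 2 + n%:R * (x * (1 - x))).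
Proof.
elim: n c => [|n ih] c; first by rewrite /= !hornerE; ring.
rewrite bernsteinS ih.
rewrite (_ : _ \o _ = fun k => a + b * (k%:R - (c - 1)) ^+ 2); last first.
  by apply/funext => k /=; rewrite -natr1; ring.
by rewrite ih -natr1; ring.
Qed.

(** Chebyshev's argument: f (k / n) - f x is dominated by a constant plus a multiple of (k - n x)^2,
    whose Bernstein sum is known exactly. *)
Lemma bernstein_cvg (f : R -> R) (F : R) :
  (forall x, 0 <= x <= 1 -> `|f x| <= F) ->
  (forall e, 0 < e -> exists2 d, 0 < d &
     forall x y, 0 <= x <= 1 -> 0 <= y <= 1 -> `|x - y| <= d ->
       `|f x - f y| <= e) ->
  forall e, 0 < e -> exists q : {poly R},
    forall x, 0 <= x <= 1 -> `|q.[x] - f x| <= e.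
Proof.
move=> fF fu e e0; have [d d0 fd] := fu _ (divr_gt0 e0 (@ltr0n R 2)).
have F0 : 0 <= F by rewrite (le_trans _ (fF 0 _)) ?lexx ?ler01.
(* When |y - x| > d, this gives K (y - x)^2 >= 2 F, which bounds |f y - f x|. *)
pose K := 2 * F / d ^+ 2.
have K0 : 0 <= K by rewrite !mulr_ge0 ?invr_ge0// ?sqr_ge0.
pose n := (Num.truncn (K / (e / 2))).+1.
have n0 : 0 < n%:R :> R by [].
have Kn : K / n%:R <= e / 2.
  rewrite ler_pdivrMr// mulrC -ler_pdivrMr; last lra.
  by rewrite ltW// truncnS_gt.
pose g k := f (k%:R / n%:R).
exists (bernstein g n) => x x01.
have key (k : nat) : (k <= n)%N ->
    `|g k - f x| <= e / 2 + K / n%:R ^+ 2 * (k%:R - n%:R * x) ^+ 2.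
  move=> kn; set y := k%:R / n%:R : R.
  have y01 : 0 <= y <= 1 by rewrite divr_ge0//= ler_pdivrMr// mul1r ler_nat.
  rewrite (_ : _ * _ ^+ 2 = K * (y - x) ^+ 2); last by rewrite /y; field; lra.
  have [yx|yx] := lerP `|y - x| d.
    by rewrite (le_trans (fd y x _ _ _))// lerDl mulr_ge0 ?sqr_ge0.
  apply: (@le_trans _ _ (2 * F)).
    by rewrite (le_trans (ler_normB _ _))// mulr_natl mulr2n lerD// fF.
  apply: ler_wpDl; first lra.
  rewrite /K mulrAC ler_pdivlMr ?exprn_gt0// ler_wpM2l//; first lra.
  by rewrite -(real_normK (num_real (y - x))) ler_sqr ?nnegrE ?normr_ge0 // ltW.
set s := K / _ in key.
have s0 : 0 <= s by rewrite divr_ge0 ?sqr_ge0.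
have Ks : s * n%:R <= e / 2.
  rewrite (le_trans _ Kn)// /s le_eqVlt; apply/orP; left; apply/eqP.
  by field; lra.
have sx : s * (n%:R * (x * (1 - x))) <= e / 2.
  rewrite mulrA (le_trans _ Ks)// ler_piMr ?mulr_ge0//; nra.
rewrite ler_norml; apply/andP; split.
- have := @bernstein_le
    (fun k => (f x - e / 2) + (- s) * (k%:R - n%:R * x) ^+ 2) g n x x01.
  rewrite bernstein_quadratic subrr expr0n/= add0r => /(_ _)/wrap[].
    by move=> k /key; rewrite ler_norml; lra.
  lra.
- have := @bernstein_le g
    (fun k => (f x + e / 2) + s * (k%:R - n%:R * x) ^+ 2) n x x01.
  rewrite bernstein_quadratic subrr expr0n/= add0r => /(_ _)/wrap[].
    by move=> k /key; rewrite ler_norml; lra.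
  lra.
Qed.

End Bernstein.

(** * Polynomial approximation of real powers *)

Section PowerApproximation.
Variable R : realType.
Implicit Types (x y s M : R).

(** A ratio w in (0, 1] satisfies w <= w^s; add this for w = x / (x + y) and w = y / (x + y), whose
    sum is 1. *)
Lemma powR_subadditive x y s : 0 <= x -> 0 <= y -> 0 < s <= 1 ->
  (x + y) `^ s <= x `^ s + y `^ s.
Proof.
move=> x0 y0 /andP[s0 s1].
have [->|xn0] := eqVneq x 0; first by rewrite add0r lerDr powR_ge0.
have [->|yn0] := eqVneq y 0; first by rewrite addr0 lerDl powR_ge0.
have xp : 0 < x by rewrite lt_def xn0.
have yp : 0 < y by rewrite lt_def yn0.
have xy : 0 < x + y by rewrite addr_gt0.
have le u : 0 < u <= x + y -> u / (x + y) * (x + y) `^ s <= u `^ s.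
  move=> /andP[u0 uxy].
  have v0 : 0 < u / (x + y) by rewrite divr_gt0.
  have uE : u `^ s = (u / (x + y)) `^ s * (x + y) `^ s.
    by rewrite -powRM ?ltW// divfK// lt0r_neq0.
  rewrite uE ler_wpM2r ?powR_ge0// ger1_powR// v0/=.
  by rewrite ler_pdivrMr// mul1r.
have := lerD (le x _) (le y _); rewrite -!mulrDl divff ?lt0r_neq0// mul1r.
by apply; apply/andP; split; lra.
Qed.

Lemma powR_holder x y s : 0 <= x -> 0 <= y -> 0 < s <= 1 ->
  `|x `^ s - y `^ s| <= `|x - y| `^ s.
Proof.
move=> x0 y0 s01.
wlog yx : x y x0 y0 / y <= x => [hw|].
  case/orP: (le_total y x) => xy; first exact: hw.
  by rewrite distrC [`|x - y|]distrC hw.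
have s0 : 0 <= s by case/andP: s01 => /ltW.
rewrite !ger0_norm ?subr_ge0 ?ge0_ler_powR ?nnegrE// lerBlDr.
by rewrite -{1}(subrK y x) powR_subadditive ?subr_ge0.
Qed.

Lemma powR_poly_approx s M : 0 <= s <= 1 -> 0 < M ->
  forall e, 0 < e -> exists q : {poly R},
    forall x, 0 <= x <= M -> `|q.[x] - x `^ s| <= e.
Proof.
move=> /andP[]; rewrite le_eqVlt => /predU1P[<- _ _ e e0|s0 s1 M0 e e0].
  (* For s = 0 the power is the constant 1, even at 0. *)
  by exists 1 => x _; rewrite hornerE powRr0 subrr normr0 ltW.
have s01 : 0 < s <= 1 by rewrite s0.
have Ms0 : 0 < M `^ s by rewrite powR_gt0.
have e'0 : 0 < e / M `^ s by rewrite divr_gt0.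
have [||q qP] := @bernstein_cvg R (fun x => x `^ s) 1 _ _ _ e'0.
- move=> x /andP[x0 x1]; rewrite ger0_norm ?powR_ge0//.
  have := @ge0_ler_powR R s (ltW s0) x 1 x0 ler01 x1; by rewrite powR1.
(* The radius inverts the Hölder modulus d^s. *)
- move=> a a0; exists (a `^ s^-1); first by rewrite powR_gt0.
  move=> x y /andP[x0 _] /andP[y0 _] xy.
  rewrite (le_trans (powR_holder _ _ _))//.
  have := @ge0_ler_powR R s (ltW s0) _ _ (normr_ge0 _) (powR_ge0 _ _) xy.
  by rewrite -powRrM mulVf ?lt0r_neq0// powRr1// ltW.
- exists (M `^ s *: (q \Po (M^-1 *: 'X))) => x /andP[x0 xM].
  rewrite hornerZ horner_comp hornerZ hornerX.
  have y01 : 0 <= M^-1 * x <= 1.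
    apply/andP; split; last by rewrite mulrC ler_pdivrMr// mul1r.
    by rewrite mulr_ge0// invr_ge0 ltW.
  have -> : x `^ s = M `^ s * (M^-1 * x) `^ s.
    rewrite -powRM ?mulVKf ?lt0r_neq0//; first exact: ltW.
    by case/andP: y01.
  by rewrite -mulrBr normrM gtr0_norm// mulrC -ler_pdivlMr// qP.
Qed.

End PowerApproximation.

(** * The underlying real inner product space *)

Section RealInner.
Variables (R : realType) (H : hilbertType R).
Implicit Types (x y z : H) (a b : R).

Definition rinner x y : R := complex.Re (inner x y).
Definition rnorm x : R := complex.Re `|x|.

Lemma conjE (z : R[i]) : Num.conj z = (z^*)%C.
Proof.
rewrite {1}[z]Crect conjC_rect ?Creal_Re ?Creal_Im// -complexRe -complexIm.
by rewrite -complexiE; case: z => a b /=; simpc.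
Qed.

Lemma normE x : `|x| = (rnorm x)%:C.
Proof. by rewrite /rnorm RRe_real ?normr_real. Qed.

Lemma rnorm_ge0 x : 0 <= rnorm x.
Proof. by rewrite -ler0c -normE. Qed.

Lemma rnormD x y : rnorm (x + y) <= rnorm x + rnorm y.
Proof. by rewrite -lecR rmorphD/= -!normE ler_normD. Qed.

Lemma rnormN x : rnorm (- x) = rnorm x.
Proof. by rewrite /rnorm normrN. Qed.

Lemma rnormB x y : rnorm (x - y) = rnorm (y - x).
Proof. by rewrite -rnormN opprB. Qed.

Lemma rnorm0 : rnorm 0 = 0.
Proof. by rewrite /rnorm normr0. Qed.

Lemma rnorm_eq0 x : (rnorm x == 0) = (x == 0).
Proof. by rewrite -[x == 0]normr_eq0 normE -(inj_eq (@complexI R)). Qed.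

Lemma rnormZ a x : rnorm (a%:C *: x) = `|a| * rnorm x.
Proof.
apply: (@complexI R); rewrite rmorphM -normE normrZ normE; congr (_ * _).
by rewrite normc_def /= expr0n/= addr0 sqrtr_sqr.
Qed.

Lemma rnorm_sqr x : rnorm x ^+ 2 = rinner x x.
Proof. by rewrite /rinner -norm_inner normE -rmorphXn. Qed.

Lemma inner_conj x y : inner x y = ((inner y x)^*)%C.
Proof. by rewrite hermC expr0 mul1r -conjE. Qed.

Lemma innerDl x y z : inner (x + y) z = inner x z + inner y z.
Proof. exact: linearDl. Qed.

Lemma innerDr x y z : inner x (y + z) = inner x y + inner x z.
Proof. exact: linearDr. Qed.

Lemma innerZl (c : R[i]) x y : inner (c *: x) y = c * inner x y.
Proof. exact: linearZl_LR. Qed.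

Lemma innerZr (c : R[i]) x y : inner x (c *: y) = (c^*)%C * inner x y.
Proof. by rewrite -conjE; exact: linearZr_LR. Qed.

Lemma innerNl x y : inner (- x) y = - inner x y.
Proof. exact: linearNl. Qed.

Lemma innerNr x y : inner x (- y) = - inner x y.
Proof. exact: linearNr. Qed.

Lemma inner0r x : inner x 0 = 0.
Proof. exact: linear0r. Qed.

Lemma rinnerC x y : rinner x y = rinner y x.
Proof. by rewrite /rinner inner_conj; case: (inner y x). Qed.

Lemma rinnerDl x y z : rinner (x + y) z = rinner x z + rinner y z.
Proof. by rewrite /rinner linearDl raddfD. Qed.

Lemma rinnerDr x y z : rinner x (y + z) = rinner x y + rinner x z.
Proof. by rewrite !(rinnerC x) rinnerDl. Qed.

Lemma rinnerZl a x y : rinner (a%:C *: x) y = a * rinner x y.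
Proof.
rewrite /rinner linearZl_LR /=; case: (inner x y) => u v /=.
by rewrite mul0r subr0.
Qed.

Lemma rinnerZr a x y : rinner x (a%:C *: y) = a * rinner x y.
Proof. by rewrite !(rinnerC x) rinnerZl. Qed.

Lemma rinnerNl x y : rinner (- x) y = - rinner x y.
Proof. by rewrite /rinner linearNl raddfN. Qed.

Lemma rinnerNr x y : rinner x (- y) = - rinner x y.
Proof. by rewrite !(rinnerC x) rinnerNl. Qed.

Lemma rinnerBl x y z : rinner (x - y) z = rinner x z - rinner y z.
Proof. by rewrite rinnerDl rinnerNl. Qed.

Lemma rinnerBr x y z : rinner x (y - z) = rinner x y - rinner x z.
Proof. by rewrite rinnerDr rinnerNr. Qed.

(** Recovers the complex product from real parts, so identities may be checked with [rinner]
    alone. *)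
Lemma inner_rinner x y : inner x y = rinner x y -i* rinner ('i%C *: x) y.
Proof.
rewrite /rinner linearZl_LR /=; case: (inner x y) => u v /=.
by congr (_ +i* _); ring.
Qed.

Lemma inner_self x : inner x x = (rnorm x ^+ 2)%:C.
Proof. by rewrite -norm_inner normE rmorphXn. Qed.

(** Cauchy-Schwarz, by expanding the squared norm of |y|^2 x - <x, y> y. *)
Lemma rinner_le x y : `|rinner x y| <= rnorm x * rnorm y.
Proof.
have [->|y0] := eqVneq y 0.
  by rewrite /rinner linear0r normr0 mulr_ge0 ?rnorm_ge0.
have ny0 : 0 < rnorm y by rewrite lt_def rnorm_eq0 y0 rnorm_ge0.
rewrite -ler_sqr ?nnegrE ?mulr_ge0 ?rnorm_ge0 ?normr_ge0//.
rewrite real_normK ?num_real//.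
have := sqr_ge0 (rnorm ((rnorm y ^+ 2)%:C *: x - (rinner x y)%:C *: y)).
rewrite [rnorm (_ - _) ^+ 2]rnorm_sqr.
rewrite !(rinnerBl, rinnerBr, rinnerZl, rinnerZr) (rinnerC y x) -!rnorm_sqr.
rewrite (_ : _ - _ =
    rnorm y ^+ 2 * ((rnorm x * rnorm y) ^+ 2 - rinner x y ^+ 2)).
  by rewrite pmulr_rge0 ?exprn_gt0// subr_ge0.
ring.
Qed.

(** Completeness with real tolerances: a positive element of [R[i]] is real. *)
Lemma rnorm_complete (u : nat -> H) :
  (forall e : R, 0 < e -> exists N, forall m n, (N <= m)%N -> (N <= n)%N ->
    rnorm (u m - u n) <= e) ->
  exists l, forall e : R, 0 < e -> exists N, forall n, (N <= n)%N ->
    rnorm (u n - l) <= e.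
Proof.
move=> uC.
have eR (e : R[i]) : 0 < e -> 0 < complex.Re e /\ e = (complex.Re e)%:C.
  by move=> e0; have := gtr0_real e0 => /RRe_real eE; rewrite -ltcR eE.
have : cvg (u @ \oo).
  apply/cauchy_cvgP/cauchy_exP => e /eR[e0 eE].
  have [N NP] := uC (complex.Re e / 2) (divr_gt0 e0 (@ltr0n R 2)).
  exists (u N), N => // n /= Nn.
  rewrite -ball_normE/= eE normE ltcR (le_lt_trans (NP _ _ _ _))//.
  by rewrite ltr_pdivrMr// mulr_natr mulr2n ltrDl.
move=> /cvg_ex[l ul]; exists l => e e0.
move/cvgrPdist_le : ul => /(_ e%:C); rewrite ltcR => /(_ e0)[N _ NP].
by exists N => n /NP /=; rewrite normE lecR rnormB.
Qed.

End RealInner.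

(** * Coercive symmetric operators: representation and inversion *)

Section Coercive.
Variables (R : realType) (H : hilbertType R).
Implicit Types (x y z : H) (a : R) (S T G : 'B(H)).

Lemma opDE S T x : (S + T) x = S x + T x. Proof. by []. Qed.
Lemma opNE T x : (- T) x = - T x. Proof. by []. Qed.
Lemma opBE S T x : (S - T) x = S x - T x. Proof. by []. Qed.
Lemma opME S T x : (S * T) x = S (T x). Proof. by []. Qed.
Lemma opZE (c : R[i]) T x : (c *: T) x = c *: T x. Proof. by []. Qed.
Lemma op1E x : (1 : 'B(H)) x = x. Proof. by []. Qed.
Lemma op0E x : (0 : 'B(H)) x = 0. Proof. by []. Qed.

Definition symmetric_op T := forall x y, inner (T x) y = inner x (T y).

Lemma op_rbounded T : exists2 M : R, 0 <= M &
  forall x, rnorm (T x) <= M * rnorm x.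
Proof.
have [M TM] := op_bounded T; exists `|M| => // x.
apply: (@le_trans _ _ (M * rnorm x)).
  by have := TM x; rewrite !normE -rmorphM lecR.
by rewrite ler_wpM2r ?rnorm_ge0// ler_norm.
Qed.

Lemma rinner_adjoint T y z :
  (forall x, rinner (T x) y = rinner x z) ->
  forall x, inner (T x) y = inner x z.
Proof. by move=> Tyz x; rewrite !inner_rinner -linearZ !Tyz. Qed.

Lemma inner_ext y z : (forall x, inner x y = inner x z) -> y = z.
Proof.
move=> yz; apply/eqP; rewrite -subr_eq0 -rnorm_eq0 -sqrf_eq0 rnorm_sqr.
by rewrite rinnerBr /rinner yz subrr.
Qed.

Lemma symmetric_rinner T : symmetric_op T ->
  forall x y, rinner (T x) y = rinner x (T y).
Proof. by move=> sT x y; rewrite /rinner sT. Qed.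

Lemma op_inj T : (forall x, T x = 0 -> x = 0) -> injective T.
Proof.
by move=> T0 x y /eqP; rewrite -subr_eq0 -linearB => /eqP/T0/subr0_eq.
Qed.

Section Variational.
Variables (G : 'B(H)) (c : R) (phi : H -> R) (K : R).
Hypotheses (c0 : 0 < c) (sG : symmetric_op G).
Hypothesis cG : forall x, c * rnorm x ^+ 2 <= rinner (G x) x.
Hypothesis phiD : forall x y, phi (x + y) = phi x + phi y.
Hypothesis phiZ : forall a x, phi (a%:C *: x) = a * phi x.
Hypothesis phiK : forall x, `|phi x| <= K * rnorm x.

(* The solution is the minimizer of the quadratic functional J: coercivity and *)
(* the parallelogram identity make minimizing sequences Cauchy.                *)
Let J z := rinner (G z) z - 2 * phi z.

Let J_lb z : - (K ^+ 2 / c) <= J z.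
Proof.
have := phiK z; rewrite ler_norml => /andP[_ pz].
have := cG z; rewrite /J; set g := rinner _ _ => cg.
have /(mulr_ge0 (ltW c0)) := sqr_ge0 (rnorm z - K / c).
have -> : c * (rnorm z - K / c) ^+ 2 =
    c * rnorm z ^+ 2 - 2 * (K * rnorm z) + K ^+ 2 / c.
  by field; rewrite lt0r_neq0.
lra.
Qed.

Let JD z x a : J (z + a%:C *: x) =
  J z + 2 * a * (rinner (G z) x - phi x) + a ^+ 2 * rinner (G x) x.
Proof.
rewrite /J linearD linearZ !(rinnerDl, rinnerDr, rinnerZl, rinnerZr) phiD phiZ.
by rewrite (symmetric_rinner sG x z) (rinnerC x); ring.
Qed.

(** J is quadratic along the line through x and y; compare its values at x, at y and at their
    midpoint. *)
Let J_mid x y (m : R) : (forall z, m <= J z) ->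
  c * rnorm (x - y) ^+ 2 <= 2 * (J x - m) + 2 * (J y - m).
Proof.
move=> mJ; have := cG (x - y); set g := rinner _ _ => cg.
have yE : y = x + (-1)%:C *: (x - y).
  by rewrite rmorphN rmorph1 scaleN1r opprB addrC subrK.
have := mJ (x + (- 2^-1)%:C *: (x - y)).
by have := JD x (x - y) (-1); rewrite -yE JD -/g; lra.
Qed.

Lemma coercive_functional : exists z, forall x, phi x = rinner (G z) x.
Proof.
pose E := [set J z | z in [set: H]].
have infE : has_inf E.
  split; first by exists (J 0), 0.
  by exists (- (K ^+ 2 / c)) => _ [z _ <-].
pose m := inf E.
have mJ z : m <= J z by apply: ge_inf; [case: infE | exists z].
have i0 (n : nat) : 0 < n.+1%:R^-1 :> R by rewrite invr_gt0.
have /choice[u uP] (n : nat) : exists z, J z < m + n.+1%:R^-1.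
  by have [_ [z _ <-] Jz] := inf_adherent (i0 n) infE; exists z.
have inv_small (e : R) : 0 < e -> exists N : nat, forall n, (N <= n)%N ->
    n.+1%:R^-1 <= e.
  move=> e0; exists (Num.truncn e^-1) => n Nn.
  rewrite -[leRHS]invrK lef_pV2 ?posrE ?invr_gt0// ltW//.
  by rewrite (lt_le_trans (truncnS_gt _))// ler_nat ltnS.
have [|l ul] := @rnorm_complete _ _ u.
  move=> e e0; have d0 : 0 < c * e ^+ 2 / 4.
    by rewrite divr_gt0 ?mulr_gt0 ?exprn_gt0.
  have [N NP] := inv_small _ d0; exists N => i j /NP iN /NP jN.
  have := J_mid (u i) (u j) mJ; have := uP i; have := uP j => uj ui uij.
  have : c * rnorm (u i - u j) ^+ 2 <= c * e ^+ 2.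
    move: uij ui uj iN jN; move: (J (u i)) (J (u j)) => a b.
    by move: (i.+1%:R^-1) (j.+1%:R^-1) => i' j'; lra.
  by rewrite ler_pM2l// ler_sqr ?nnegrE ?rnorm_ge0//; exact: ltW.
have [M M0 GM] := op_rbounded G.
exists l => x; apply/eqP; rewrite -subr_eq0 -oppr_eq0 opprB; apply/eqP.
set g := rinner (G x) x; set r := _ - _.
have g0 : 0 <= g by apply: le_trans (cG x); rewrite mulr_ge0 ?sqr_ge0 ?ltW.
(* This is J (l + a x) >= J l, obtained in the limit from the near-minimizers u_n, without proving
   that J is continuous. *)
have Jl a : 0 <= 2 * a * r + a ^+ 2 * g.
  apply/ler_addgt0Pl => e e0.
  pose L := 2 * `|a| * (M * rnorm x) + 1.
  have L0 : 0 < L by rewrite ltr_wpDl ?mulr_ge0 ?rnorm_ge0.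
  have [N NP] := inv_small _ (divr_gt0 e0 (@ltr0n R 2)).
  have [N' N'P] := ul _ (divr_gt0 (divr_gt0 e0 (@ltr0n R 2)) L0).
  pose n := maxn N N'; have nN := NP n (leq_maxl _ _).
  have /= nN' := N'P n (leq_maxr _ _).
  have rE : r = rinner (G (u n)) x - phi x - rinner (G (u n - l)) x.
    by rewrite /r linearB rinnerBl; ring.
  have := mJ (u n + a%:C *: x); rewrite JD -/g => mn.
  have := uP n => un.
  have le1 : `|2 * a * rinner (G (u n - l)) x| <= e / 2.
    rewrite 2!normrM (@ger0_norm _ 2)//.
    apply: (@le_trans _ _ (2 * `|a| * (M * rnorm (u n - l) * rnorm x))).
      rewrite ler_wpM2l ?mulr_ge0// (le_trans (rinner_le _ _))//.
      by rewrite ler_wpM2r ?rnorm_ge0.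
    apply: (@le_trans _ _ (L * rnorm (u n - l))).
      rewrite [leLHS](_ : _ = (L - 1) * rnorm (u n - l)); last first.
        by rewrite /L; ring.
      by rewrite ler_wpM2r ?rnorm_ge0// gerDl lerN10.
    by rewrite mulrC -ler_pdivlMr.
  move: le1; rewrite ler_norml rE; set q := rinner _ x => /andP[le1 le2].
  move: mn un nN; move: (J _) (rinner _ x - phi x) (n.+1%:R^-1) => j w d; lra.
(* A near-optimal a; the added 1 avoids dividing by g = 0. The bound becomes a nonpositive multiple
   of r^2, which forces r = 0. *)
have := Jl (- r / (g + 1)).
have g1 : g + 1 != 0 by rewrite lt0r_neq0// ltr_wpDl.
rewrite (_ : _ + _ = - ((r / (g + 1)) ^+ 2 * (g + 2))); last by field.
rewrite oppr_ge0 pmulr_lle0; last lra.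
move=> r0; have := sqr_ge0 (r / (g + 1)) => r1.
have /eqP : (r / (g + 1)) ^+ 2 = 0 by apply/eqP; rewrite eq_le r0 r1.
by rewrite sqrf_eq0 mulf_eq0 invr_eq0 (negPf g1) orbF => /eqP.
Qed.

End Variational.

Lemma coercive_inj G c : 0 < c ->
  (forall x, c * rnorm x ^+ 2 <= rinner (G x) x) -> injective G.
Proof.
move=> c0 cG; apply: op_inj => x Gx0; have := cG x.
rewrite Gx0 /rinner linear0l pmulr_rle0// => h; apply/eqP.
by rewrite -rnorm_eq0 -sqrf_eq0 eq_le h sqr_ge0.
Qed.

(* G = 1 gives the adjoint of T (Riesz), and T = 1 the inverse of G.           *)
Lemma coercive_solve G T c : 0 < c -> symmetric_op G ->
  (forall x, c * rnorm x ^+ 2 <= rinner (G x) x) ->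
  exists S, forall x y, inner (T x) y = inner x (G (S y)).
Proof.
move=> c0 sG cG; have [M M0 TM] := op_rbounded T.
have /choice[s sP] y : exists z, forall x, rinner (T x) y = rinner (G z) x.
  apply: (@coercive_functional G c _ (M * rnorm y)) => //.
  - by move=> u v; rewrite linearD rinnerDl.
  - by move=> a u; rewrite linearZ rinnerZl.
  - move=> x; rewrite (le_trans (rinner_le _ _))// mulrAC.
    by rewrite ler_wpM2r ?rnorm_ge0.
have iG := coercive_inj c0 cG.
have {}sP y x : inner (T x) y = inner x (G (s y)).
  by apply: rinner_adjoint => {}x; rewrite sP rinnerC.
have sl : linear s.
  move=> a y z; apply/iG/inner_ext => x; rewrite -sP.
  by rewrite [G _]linearP !innerDr !innerZr -!sP.
(* Testing at x = s y gives c |s y|^2 <= <T (s y), y> <= M |s y| |y|. *)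
have sb : exists N : R, forall y, `|s y| <= N%:C * `|y|.
  exists (M / c) => y; rewrite !normE -rmorphM lecR.
  have [->|sy0] := eqVneq (s y) 0.
    by rewrite rnorm0 mulr_ge0 ?divr_ge0 ?rnorm_ge0// ltW.
  have sy1 : 0 < rnorm (s y) by rewrite lt_def rnorm_eq0 sy0 rnorm_ge0.
  rewrite mulrAC ler_pdivlMr// -(ler_pM2r sy1).
  apply: (@le_trans _ _ (rinner (T (s y)) y)).
    rewrite {1}/rinner sP -/(rinner _ _) rinnerC (le_trans _ (cG _))//.
    by rewrite mulrAC -expr2 mulrC.
  rewrite (le_trans (ler_norm _))// (le_trans (rinner_le _ _))//.
  by rewrite mulrAC ler_wpM2r ?rnorm_ge0.
by exists (BoundedOp sl sb) => x y; rewrite sP.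
Qed.

End Coercive.

(** * Adjoints, symmetric operators and the spectrum of a positive operator *)

Section Adjoint.
Variables (R : realType) (H : hilbertType R).
Implicit Types (x y z : H) (S T G : 'B(H)).

Lemma adjointP T x y : inner (T x) y = inner x (adjoint T y).
Proof.
have [//||S SP] := @coercive_solve R H 1 T 1 ltr01.
  by move=> u; rewrite mul1r rnorm_sqr.
have : [set S : 'B(H) | forall x y, inner (T x) y = inner x (S y)] S by [].
by move=> /(xgetI 0); apply.
Qed.

Lemma symmetric_adjointM T : symmetric_op (adjoint T * T).
Proof.
by move=> x y; rewrite !opME -adjointP inner_conj -adjointP -inner_conj.
Qed.

Lemma rinner_adjointM T x : rinner ((adjoint T * T) x) x = rnorm (T x) ^+ 2.
Proof. by rewrite rinnerC /rinner -adjointP rnorm_sqr. Qed.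

Lemma symmetric_opD S T :
  symmetric_op S -> symmetric_op T -> symmetric_op (S + T).
Proof. by move=> sS sT x y; rewrite !opDE innerDl innerDr sS sT. Qed.

Lemma symmetric_opN T : symmetric_op T -> symmetric_op (- T).
Proof. by move=> sT x y; rewrite !opNE innerNl innerNr sT. Qed.

Lemma symmetric_opZ (a : R) T : symmetric_op T -> symmetric_op (a%:C *: T).
Proof. by move=> sT x y; rewrite !opZE innerZl innerZr conjc_real sT. Qed.

Lemma symmetric_opX T n : symmetric_op T -> symmetric_op (T ^+ n).
Proof.
by move=> sT; elim: n => [//|n ih] x y; rewrite {1}exprS exprSr !opME sT ih.
Qed.

Lemma symmetric_op_horner (q : {poly R}) T :
  symmetric_op T -> symmetric_op (op_horner q T).
Proof.
move=> sT; rewrite /op_horner; elim/big_ind: _ => //.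
- by move=> x y; rewrite !op0E /= linear0l linear0r.
- exact: symmetric_opD.
- by move=> i _; apply/symmetric_opZ/symmetric_opX.
Qed.

Lemma coercive_unit G (c : R) : 0 < c -> symmetric_op G ->
  (forall x, c * rnorm x ^+ 2 <= rinner (G x) x) ->
  exists S : 'B(H), S * G = 1 /\ G * S = 1.
Proof.
move=> c0 sG cG; have [S SP] := coercive_solve 1 c0 sG cG.
have GS x : G (S x) = x by apply: inner_ext => y; rewrite -SP.
exists S; split; apply: opP => x; rewrite opME ?GS//.
by apply: (coercive_inj c0 cG); rewrite GS.
Qed.

(** For a < 0 the operator T - a is coercive with constant -a; for a > M its opposite is coercive
    with constant a - M. Either way [coercive_unit] inverts it. *)
Lemma positive_spectrum T (M : R) : symmetric_op T ->
  (forall x, 0 <= rinner (T x) x) ->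
  (forall x, rnorm (T x) <= M * rnorm x) ->
  forall a : R, spectrum T a%:C -> 0 <= a <= M.
Proof.
move=> sT T0 TM a; apply: contra_notP => /negP; rewrite negb_and -!ltNge.
have sTa : symmetric_op (T - a%:C *: (1 : 'B(H))).
  by apply/symmetric_opD/symmetric_opN/symmetric_opZ.
have TaE x : rinner ((T - a%:C *: (1 : 'B(H))) x) x =
    rinner (T x) x - a * rnorm x ^+ 2.
  by rewrite opBE opZE op1E rinnerBl rinnerZl rnorm_sqr.
case/orP => [a0|Ma].
  apply: (@coercive_unit _ (- a)); rewrite ?oppr_gt0// => x.
  by rewrite TaE mulNr lerDr.
have [||x|S [S1 S2]] := @coercive_unit (- (T - a%:C *: (1 : 'B(H)))) (a - M).
- by rewrite subr_gt0.
- exact: symmetric_opN.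
- rewrite opNE rinnerNl TaE mulrBl opprB lerB//.
  rewrite (le_trans (ler_norm _))// (le_trans (rinner_le _ _))//.
  by rewrite expr2 mulrA ler_wpM2r ?rnorm_ge0.
- by exists (- S); split; [rewrite mulNr -mulrN S1 | rewrite mulrN -mulNr S2].
Qed.

End Adjoint.

(** * Polynomials in an operator *)

Section PolynomialCalculus.
Variables (R : realType) (H : hilbertType R) (T : 'B(H)).
Implicit Types (p q : {poly R[i]}) (c : R[i]).

(** Complex coefficients are allowed so that real polynomials can be split into linear factors. *)
Definition op_eval p : 'B(H) := \sum_(i < size p) p`_i *: T ^+ i.

Lemma op_eval_widen n p : (size p <= n)%N ->
  op_eval p = \sum_(i < n) p`_i *: T ^+ i.
Proof.
move=> pn; rewrite /op_eval (big_ord_widen _ (fun i => p`_i *: T ^+ i) pn).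
rewrite big_mkcond; apply: eq_bigr => i _; case: ltnP => // ip.
by rewrite nth_default// scale0r.
Qed.

Lemma op_evalD p q : op_eval (p + q) = op_eval p + op_eval q.
Proof.
rewrite (op_eval_widen (size_polyD p q)) (op_eval_widen (leq_maxl _ (size q))).
rewrite (op_eval_widen (leq_maxr (size p) _)) -big_split.
by apply: eq_bigr => i _; rewrite coefD scalerDl.
Qed.

Lemma op_evalZ c p : op_eval (c *: p) = c *: op_eval p.
Proof.
rewrite (op_eval_widen (size_scale_leq c p)) scaler_sumr.
by apply: eq_bigr => i _; rewrite coefZ scalerA.
Qed.

Lemma op_evalC c : op_eval c%:P = c *: (1 : 'B(H)).
Proof. by rewrite (op_eval_widen (size_polyC_leq1 c)) big_ord1 coefC. Qed.

Lemma op_scaleAl c (S U : 'B(H)) : c *: (S * U) = (c *: S) * U.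
Proof. exact: opP. Qed.

Lemma op_scaleAr c (S U : 'B(H)) : c *: (S * U) = S * (c *: U).
Proof. by apply: opP => x; rewrite !(opZE, opME) linearZ. Qed.

Lemma op_evalXM p : op_eval ('X * p) = T * op_eval p.
Proof.
have [->|p0] := eqVneq p 0.
  by rewrite mulr0 /op_eval size_poly0 big_ord0 mulr0.
rewrite {1}/op_eval mulrC size_mulX// big_ord_recl coefMX scale0r add0r.
rewrite mulr_sumr.
by apply: eq_bigr => i _; rewrite coefMX /= -op_scaleAr exprS.
Qed.

Lemma op_evalM p q : op_eval (p * q) = op_eval p * op_eval q.
Proof.
elim/poly_ind: p => [|p c ih].
  by rewrite mul0r /op_eval size_poly0 big_ord0 mul0r.
rewrite mulrDl -mulrA ['X * q]mulrC mulrA [p * q * 'X]mulrC mul_polyC.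
rewrite !op_evalD op_evalZ op_evalXM ih [p * 'X]mulrC op_evalXM op_evalC.
by rewrite mulrDl mulrA -op_scaleAl mul1r.
Qed.

Lemma op_evalXsubC c : op_eval ('X - c%:P) = T - c *: (1 : 'B(H)).
Proof.
rewrite -polyCN op_evalD op_evalC scaleNr -['X]mulr1 op_evalXM.
by rewrite -polyC1 op_evalC scale1r mulr1.
Qed.

Lemma op_horner_eval (q : {poly R}) :
  op_horner q T = op_eval (map_poly (real_complex R) q).
Proof.
by rewrite /op_eval size_map_poly; apply: eq_bigr => i _; rewrite coef_map.
Qed.

Lemma op_hornerM (p q : {poly R}) :
  op_horner (p * q) T = op_horner p T * op_horner q T.
Proof. by rewrite !op_horner_eval rmorphM op_evalM. Qed.

Lemma op_hornerB (p q : {poly R}) :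
  op_horner (p - q) T = op_horner p T - op_horner q T.
Proof.
by rewrite !op_horner_eval rmorphB op_evalD -scaleN1r op_evalZ scaleN1r.
Qed.

Lemma op_hornerC (a : R) : op_horner a%:P T = a%:C *: (1 : 'B(H)).
Proof. by rewrite op_horner_eval map_polyC op_evalC. Qed.

Lemma op_hornerX : op_horner 'X T = T.
Proof.
rewrite op_horner_eval map_polyX -['X]subr0 -polyC0 op_evalXsubC.
by rewrite scale0r subr0.
Qed.

End PolynomialCalculus.

(** * Operator norm and lower bounds *)

Section OperatorNorm.
Variables (R : realType) (H : hilbertType R).
Implicit Types (x y : H) (S T : 'B(H)) (M : R).

Definition op_norm T : R :=
  inf [set M | 0 <= M /\ forall x, rnorm (T x) <= M * rnorm x].

Let bounds T := [set M | 0 <= M /\ forall x, rnorm (T x) <= M * rnorm x].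

Let bounds_neq0 T : (bounds T !=set0)%classic.
Proof. by have [M M0 TM] := op_rbounded T; exists M. Qed.

Lemma op_norm_ge0 T : 0 <= op_norm T.
Proof. by apply: lb_le_inf (bounds_neq0 T) _ => M []. Qed.

Lemma op_normP T x : rnorm (T x) <= op_norm T * rnorm x.
Proof.
have [->|x0] := eqVneq x 0; first by rewrite linear0 rnorm0 mulr0.
have nx0 : 0 < rnorm x by rewrite lt_def rnorm_eq0 x0 rnorm_ge0.
rewrite -ler_pdivrMr//; apply: lb_le_inf (bounds_neq0 T) _ => M [_ TM].
by rewrite ler_pdivrMr.
Qed.

Lemma op_norm_le T M : 0 <= M -> (forall x, rnorm (T x) <= M * rnorm x) ->
  op_norm T <= M.
Proof. by move=> M0 TM; apply: ge_inf; [exists 0 => N [] | split]. Qed.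

Definition bounded_below T := exists2 c : R, 0 < c &
  forall x, c * rnorm x <= rnorm (T x).

Lemma bounded_belowM S T :
  bounded_below S -> bounded_below T -> bounded_below (S * T).
Proof.
move=> [c c0 cS] [d d0 dT]; exists (c * d); first exact: mulr_gt0.
by move=> x; rewrite -mulrA (le_trans _ (cS _))// ler_pM2l.
Qed.

(** An inverse of norm at most M gives the lower bound 1 / (M + 1). *)
Lemma not_bounded_below_spectrum T (z : R[i]) :
  ~ bounded_below (T - z *: (1 : 'B(H))) -> spectrum T z.
Proof.
move=> nb [S [ST _]]; apply: nb; have [M M0 SM] := op_rbounded S.
exists (M + 1)^-1 => [|x]; first by rewrite invr_gt0 ltr_wpDl.
rewrite mulrC ler_pdivrMr ?ltr_wpDl//.
have {1}-> : x = S ((T - z *: (1 : 'B(H))) x) by rewrite -opME ST.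
by rewrite (le_trans (SM _))// mulrC ler_wpM2l ?rnorm_ge0// lerDl.
Qed.

(** Since <T x, x> is real, pairing (T - z) x with i x isolates Im z |x|^2; conclude by
    Cauchy-Schwarz. *)
Lemma symmetric_bounded_below T (z : R[i]) : symmetric_op T ->
  complex.Im z != 0 -> bounded_below (T - z *: (1 : 'B(H))).
Proof.
move=> sT z0; exists `|complex.Im z| => [|x]; first by rewrite normr_gt0.
have [->|x0] := eqVneq x 0; first by rewrite linear0 rnorm0 mulr0.
have nx0 : 0 < rnorm x by rewrite lt_def rnorm_eq0 x0 rnorm_ge0.
rewrite -(ler_pM2r nx0) -mulrA -expr2.
have ImT : complex.Im (inner (T x) x) = 0.
  have := inner_conj (T x) x; rewrite -sT.
  by case: (inner _ _) => a b [] /=; lra.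
have -> : `|complex.Im z| * rnorm x ^+ 2 =
    `|rinner ((T - z *: (1 : 'B(H))) x) ('i%C *: x)|.
  rewrite -{1}[rnorm x ^+ 2]ger0_norm ?sqr_ge0// -normrM.
  rewrite /rinner opBE opZE op1E innerZr innerDl innerNl innerZl inner_self.
  case: (inner (T x) x) ImT => a b /= ->; case: z {z0} => u v /=.
  by rewrite -[RHS]normrN; congr `|_|; ring.
rewrite (le_trans (rinner_le _ _))// ler_wpM2l ?rnorm_ge0//.
by rewrite /rnorm normrZ normc_def /= expr0n expr1n add0r sqrtr1 mul1r.
Qed.

(* From |S^2 x| <= N |S x| one gets                                            *)
(*   |(S^2 - N^2) x|^2 <= N^2 (N^2 |x|^2 - |S x|^2),                           *)
(* so a lower bound c |x| would make sqrt (N^2 - c^2 / N^2) < N a bound for S. *)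
Lemma bounded_below_norm S : symmetric_op S -> (exists x : H, x != 0) ->
  ~ bounded_below (S * S - (op_norm S ^+ 2)%:C *: (1 : 'B(H))).
Proof.
move=> sS [x0 x0N0] [c c0 cP]; set N := op_norm S in cP *.
have nx0 : 0 < rnorm x0 by rewrite lt_def rnorm_eq0 x0N0 rnorm_ge0.
have N0 : 0 <= N := op_norm_ge0 S.
have key x : c ^+ 2 * rnorm x ^+ 2 <=
    N ^+ 2 * (N ^+ 2 * rnorm x ^+ 2 - rnorm (S x) ^+ 2).
  have c0' := ltW c0.
  have := cP x; rewrite -ler_sqr ?nnegrE ?mulr_ge0 ?rnorm_ge0// exprMn.
  move=> /le_trans; apply.
  rewrite opBE opZE op1E opME.
  rewrite [rnorm (_ - _) ^+ 2]rnorm_sqr.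
  rewrite !(rinnerBl, rinnerBr, rinnerZl, rinnerZr).
  rewrite (rinnerC x) (symmetric_rinner sS (S x) x) -!rnorm_sqr.
  have : rnorm (S (S x)) ^+ 2 <= N ^+ 2 * rnorm (S x) ^+ 2.
    by rewrite -exprMn ler_sqr ?nnegrE ?mulr_ge0 ?rnorm_ge0// op_normP.
  move: (rnorm (S (S x)) ^+ 2) (rnorm (S x) ^+ 2) (rnorm x ^+ 2) => a b d; nra.
have N1 : 0 < N.
  rewrite lt_def N0 andbT; apply: contraTneq (key x0) => ->.
  by rewrite expr0n/= mul0r -ltNge mulr_gt0 ?exprn_gt0.
pose K2 := N ^+ 2 - c ^+ 2 / N ^+ 2.
have SK x : rnorm (S x) ^+ 2 <= K2 * rnorm x ^+ 2.
  rewrite -(ler_pM2l (exprn_gt0 2 N1)); have := key x.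
  have -> : N ^+ 2 * (K2 * rnorm x ^+ 2) =
    N ^+ 2 * (N ^+ 2 * rnorm x ^+ 2) - c ^+ 2 * rnorm x ^+ 2.
    by rewrite /K2; field; rewrite lt0r_neq0.
  lra.
have K20 : 0 <= K2.
  have := le_trans (sqr_ge0 _) (SK x0).
  by rewrite pmulr_lge0// exprn_gt0.
have : N <= Num.sqrt K2.
  apply: op_norm_le; first exact: sqrtr_ge0.
  move=> x; rewrite -ler_sqr ?nnegrE ?mulr_ge0 ?rnorm_ge0 ?sqrtr_ge0//.
  by rewrite exprMn sqr_sqrtr.
rewrite -ler_sqr ?nnegrE ?sqrtr_ge0// sqr_sqrtr// /K2 lerDl oppr_ge0 leNgt.
by rewrite divr_gt0 ?exprn_gt0.
Qed.

End OperatorNorm.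

(** * The norm of a polynomial in a symmetric operator *)

Section SpectralBound.
Variables (R : realType) (H : hilbertType R) (T : 'B(H)).
Hypothesis sT : symmetric_op T.
Implicit Types (q : {poly R}) (a M : R).

(** A product of factors bounded below is bounded below, so some linear factor T - z is not; by
    symmetry z is real. *)
Lemma spectrum_poly_root q : q != 0 -> ~ bounded_below (op_horner q T) ->
  exists2 a, spectrum T a%:C & root q a.
Proof.
move=> q0 nb.
have [r qE] := closed_field_poly_normal (map_poly (real_complex R) q).
have [z zr nz] : exists2 z, z \in r & ~ bounded_below (T - z *: (1 : 'B(H))).
  apply: contrapT => allb; apply: nb; rewrite op_horner_eval qE op_evalZ.
  have [c c0 cP] : bounded_below (op_eval T (\prod_(z <- r) ('X - z%:P))).
    rewrite big_seq; elim/big_ind: _ => [|p1 p2|z zr].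
    - by rewrite -polyC1 op_evalC scale1r; exists 1 => // x; rewrite mul1r.
    - by rewrite op_evalM; exact: bounded_belowM.
    - by rewrite op_evalXsubC; apply: contrapT => nz; apply: allb; exists z.
  have l0 : lead_coef (map_poly (real_complex R) q) != 0.
    by rewrite lead_coef_eq0 map_poly_eq0.
  set l := lead_coef _ in l0 *.
  have lE : `|l| = (complex.Re `|l|)%:C by rewrite RRe_real ?normr_real.
  have lp : 0 < complex.Re `|l| by rewrite -ltcR -lE normr_gt0.
  exists (complex.Re `|l| * c) => [|x]; first exact: mulr_gt0.
  rewrite opZE -lecR -normE normrZ lE normE -rmorphM lecR -mulrA.
  by rewrite ler_pM2l.
have zR : z = (complex.Re z)%:C.
  case: z {zr} nz => u v nz /=; congr (_ +i* _); apply/eqP.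
  by apply/negPn/negP => v0; apply: nz; exact: symmetric_bounded_below.
exists (complex.Re z); rewrite -?zR; first exact: not_bounded_below_spectrum.
rewrite -(fmorph_root (real_complex R)) /= -zR qE rootZ; last first.
  by rewrite lead_coef_eq0 map_poly_eq0.
by rewrite root_prod_XsubC.
Qed.

Let norm_root q : (exists x : H, x != 0) ->
  q ^+ 2 - (op_norm (op_horner q T) ^+ 2)%:P != 0 ->
  exists2 a, spectrum T a%:C & `|q.[a]| = op_norm (op_horner q T).
Proof.
move=> H0 /spectrum_poly_root[|a aT].
  rewrite op_hornerB expr2 op_hornerM op_hornerC.
  by apply: bounded_below_norm => //; exact: symmetric_op_horner.
rewrite rootE !hornerE subr_eq0 => /eqP qa; exists a => //.
apply/eqP; rewrite -(eqrXn2 (n := 2)) ?op_norm_ge0// real_normK ?num_real//.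
by rewrite qa.
Qed.

(** For q = X the polynomial X^2 - N^2 is monic, hence nonzero, and [norm_root] applies. *)
Lemma spectrum_nonempty : (exists x : H, x != 0) -> exists a, spectrum T a%:C.
Proof.
move=> H0; have [|a aT _] := @norm_root 'X H0; last by exists a.
by apply: monic_neq0; exact: monicXnsubC.
Qed.

Lemma op_horner_bound q M : 0 <= M ->
  (forall a, spectrum T a%:C -> `|q.[a]| <= M) ->
  forall x, rnorm (op_horner q T x) <= M * rnorm x.
Proof.
move=> M0 qM x; have [->|x0] := eqVneq x 0.
  by rewrite linear0 rnorm0 mulr0.
have H0 : exists x : H, x != 0 by exists x.
apply: le_trans (op_normP _ _) _; rewrite ler_wpM2r ?rnorm_ge0//.
set N := op_norm _.
have [a aT <-] : exists2 a, spectrum T a%:C & `|q.[a]| = N; last exact: qM.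
(* If q^2 is the constant N^2, then |q| = N everywhere and any spectral point will do. *)
have [qE|/norm_root] := eqVneq (q ^+ 2 - (N ^+ 2)%:P) 0; last exact.
have [a aT] := spectrum_nonempty H0; exists a => //.
apply/eqP; rewrite -(eqrXn2 (n := 2)) ?op_norm_ge0// real_normK ?num_real//.
by have := congr1 (horner^~ a) qE; rewrite !hornerE => /subr0_eq->.
Qed.

End SpectralBound.

(** * Limits in operator norm *)

Section OperatorLimits.
Variables (R : realType) (H : hilbertType R).
Implicit Types (x y : H) (S T : 'B(H)) (M e : R).

Lemma nbhs_inftyP (P : nat -> Prop) :
  (\forall n \near \oo, P n) <-> exists N, forall n, (N <= n)%N -> P n.
Proof. by split=> [[N _ NP]|[N NP]]; exists N. Qed.

Lemma op_cvgP (T_ : nat -> 'B(H)) T : op_cvg T_ T <->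
  forall e, 0 < e -> exists N, forall n, (N <= n)%N ->
    forall x, rnorm (T_ n x - T x) <= e * rnorm x.
Proof.
split=> cT e e0.
  have /nbhs_inftyP[N NP] := cT e e0; exists N => n /NP h x.
  by have := h x; rewrite !normE -rmorphM lecR.
have [N NP] := cT e e0; apply/nbhs_inftyP; exists N => n /NP h x.
by rewrite !normE -rmorphM lecR.
Qed.

Lemma rnorm_le0 x : (forall e, 0 < e -> rnorm x <= e) -> x = 0.
Proof.
move=> xe; apply/eqP; rewrite -rnorm_eq0 eq_le rnorm_ge0 andbT.
by apply/ler_addgt0Pl => e /xe; rewrite addr0.
Qed.

Lemma op_cvg_pointwise (T_ : nat -> 'B(H)) T x : op_cvg T_ T ->
  forall e, 0 < e -> exists N, forall n, (N <= n)%N ->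
    rnorm (T_ n x - T x) <= e.
Proof.
move=> /op_cvgP cT e e0.
have x1 : 0 < rnorm x + 1 by rewrite ltr_wpDl ?rnorm_ge0.
have [N NP] := cT _ (divr_gt0 e0 x1); exists N => n /NP/(_ x) /le_trans; apply.
by rewrite mulrAC ler_pdivrMr// ler_pM2l// lerDl.
Qed.

Lemma op_cvg_uniq (T_ : nat -> 'B(H)) S T : op_cvg T_ S -> op_cvg T_ T -> S = T.
Proof.
move=> cS cT; apply: opP => x; apply/eqP; rewrite -subr_eq0; apply/eqP.
apply: rnorm_le0 => e e0.
have [N NP] := op_cvg_pointwise x cS (divr_gt0 e0 (@ltr0n R 2)).
have [N' N'P] := op_cvg_pointwise x cT (divr_gt0 e0 (@ltr0n R 2)).
have := NP _ (leq_maxl N N'); have := N'P _ (leq_maxr N N').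
set y := T_ _ x => h1 h2; have := rnormD (S x - y) (y - T x).
by rewrite addrA subrK (rnormB (S x)); lra.
Qed.

Lemma op_cvgM (S_ T_ : nat -> 'B(H)) S T : op_cvg S_ S -> op_cvg T_ T ->
  op_cvg (fun n => S_ n * T_ n) (S * T).
Proof.
move=> /op_cvgP cS /op_cvgP cT; apply/op_cvgP => e e0.
have [M M0 SM] := op_rbounded S; have [N N0 TN] := op_rbounded T.
have M1 : 0 < M + 1 by rewrite ltr_wpDl.
have N1 : 0 < N + 1 by rewrite ltr_wpDl.
have e2 : 0 < e / 2 by rewrite divr_gt0.
have [n1 n1P] := cS _ (divr_gt0 e2 N1).
have [n2 n2P] := cT _ (divr_gt0 e2 M1).
have [n3 n3P] := cT _ ltr01.
exists (maxn n1 (maxn n2 n3)) => n; rewrite !geq_max.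
move=> /and3P[/n1P h1 /n2P h2 /n3P h3] x.
have -> : (S_ n * T_ n) x - (S * T) x =
    (S_ n (T_ n x) - S (T_ n x)) + S (T_ n x - T x).
  by rewrite linearB /= addrA subrK.
apply: le_trans (rnormD _ _) _; rewrite (splitr e) mulrDl lerD//.
  apply: le_trans (h1 _) _.
  rewrite mulrAC ler_pdivrMr// -[leRHS]mulrA ler_pM2l//.
  rewrite -(subrK (T x) (T_ n x)) (le_trans (rnormD _ _))//.
  by rewrite [leRHS]mulrC mulrDl mul1r addrC lerD// (le_trans (h3 _))// mul1r.
apply: le_trans (SM _) _; apply: le_trans (ler_wpM2l M0 (h2 x)) _.
rewrite mulrA ler_wpM2r ?rnorm_ge0// mulrCA ler_piMr ?(ltW e2)//.
by rewrite ler_pdivrMr// mul1r lerDl.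
Qed.

Lemma op_complete (T_ : nat -> 'B(H)) :
  (forall e, 0 < e -> exists N, forall m n, (N <= m)%N -> (N <= n)%N ->
    forall x, rnorm (T_ m x - T_ n x) <= e * rnorm x) ->
  exists T, op_cvg T_ T.
Proof.
move=> TC.
have /choice[l lP] x : exists l, forall e, 0 < e -> exists N, forall n,
    (N <= n)%N -> rnorm (T_ n x - l) <= e.
  apply: rnorm_complete => e e0.
  have x1 : 0 < rnorm x + 1 by rewrite ltr_wpDl ?rnorm_ge0.
  have [N NP] := TC _ (divr_gt0 e0 x1); exists N => m n mN nN.
  apply: le_trans (NP _ _ mN nN _) _.
  by rewrite mulrAC ler_pdivrMr// ler_pM2l// lerDl.
(* Letting one index of the Cauchy estimate tend to infinity makes the pointwise convergence
   uniform. *)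
have lu e : 0 < e -> exists N, forall n, (N <= n)%N ->
    forall x, rnorm (T_ n x - l x) <= e * rnorm x.
  move=> e0; have [N NP] := TC e e0; exists N => n nN x.
  apply/ler_addgt0Pr => d d0; have [N' N'P] := lP x d d0.
  have h1 := NP _ _ nN (leq_maxl N N') x; have h2 := N'P _ (leq_maxr N N').
  move: h1 h2; set y := T_ (maxn _ _) x => h1 h2.
  by have := rnormD (T_ n x - y) (y - l x); rewrite addrA subrK; lra.
have ll : linear l.
  move=> a x y; apply/eqP; rewrite -subr_eq0; apply/eqP/rnorm_le0 => e e0.
  pose K := rnorm (a *: x + y) + (rnorm (a *: x) + rnorm y) + 1.
  have K0 : 0 < K by rewrite ltr_wpDl// !addr_ge0 ?rnorm_ge0.
  have aE (z : H) : rnorm (a *: z) = complex.Re `|a| * rnorm z.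
    rewrite /rnorm normrZ normE; case: (`|a|) => u v /=; ring.
  have [n /(_ n (leqnn n)) h] := lu _ (divr_gt0 e0 K0).
  have -> : l (a *: x + y) - (a *: l x + l y) =
      (l (a *: x + y) - T_ n (a *: x + y)) +
      (a *: (T_ n x - l x) + (T_ n y - l y)).
    by rewrite op_linear scalerBr (addrACA (a *: T_ n x)) -opprD addrA subrK.
  apply: le_trans (rnormD _ _) _; rewrite rnormB.
  apply: le_trans (lerD (h _) (rnormD _ _)) _; rewrite aE.
  have Ra0 : 0 <= complex.Re `|a|.
    by rewrite -ler0c RRe_real ?normr_real.
  apply: (@le_trans _ _
    (e / K * (rnorm (a *: x + y) + (rnorm (a *: x) + rnorm y)))).
    by rewrite !mulrDr lerD2l lerD// (aE x) mulrCA ler_wpM2l.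
  by rewrite mulrAC ler_pdivrMr// ler_pM2l// /K lerDl.
have lb : exists M : R, forall x, `|l x| <= M%:C * `|x|.
  have [n /(_ n (leqnn n)) h] := lu 1 ltr01.
  have [M M0 TM] := op_rbounded (T_ n).
  exists (1 + M) => x; rewrite !normE -rmorphM lecR mulrDl.
  have -> : l x = (l x - T_ n x) + T_ n x by rewrite subrK.
  by rewrite (le_trans (rnormD _ _))// lerD// rnormB.
by exists (BoundedOp ll lb); apply/op_cvgP.
Qed.

End OperatorLimits.

(** * Continuous functional calculus of a symmetric operator *)

Section FunctionalCalculus.
Variables (R : realType) (H : hilbertType R) (T : 'B(H)).
Hypothesis sT : symmetric_op T.
Implicit Types (f g : R -> R) (q : {poly R}) (S : 'B(H)) (e a M : R).

Let spec a := spectrum T a%:C.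

Lemma is_fun_calcP f S : is_fun_calc f T S <-> exists q : nat -> {poly R},
  (forall e, 0 < e -> exists N, forall n, (N <= n)%N ->
     forall a, spectrum T a%:C -> `|(q n).[a] - f a| <= e) /\
  op_cvg (fun n => op_horner (q n) T) S.
Proof.
by split=> [] [q [qf qS]]; exists q; split=> // e e0;
  apply/nbhs_inftyP; exact: qf.
Qed.

Lemma is_fun_calc_exists f :
  (forall e, 0 < e -> exists q, forall a, spec a -> `|q.[a] - f a| <= e) ->
  exists S, is_fun_calc f T S.
Proof.
move=> fq.
have /choice[q qP] (n : nat) : exists q, forall a, spec a ->
    `|q.[a] - f a| <= n.+1%:R^-1.
  by apply: fq; rewrite invr_gt0.
have qf e : 0 < e -> exists N, forall n, (N <= n)%N ->
     forall a, spec a -> `|(q n).[a] - f a| <= e.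
  move=> e0; exists (Num.truncn e^-1) => n Nn a /(qP n)/le_trans; apply.
  rewrite -[leRHS]invrK lef_pV2 ?posrE ?invr_gt0// ltW//.
  by rewrite (lt_le_trans (truncnS_gt _))// ler_nat ltnS.
have [|S SP] := @op_complete _ _ (fun n => op_horner (q n) T).
  move=> e e0; have [N NP] := qf _ (divr_gt0 e0 (@ltr0n R 2)).
  exists N => m n mN nN x; rewrite -opBE -op_hornerB.
  apply: op_horner_bound => // [|a aT]; first exact: ltW.
  rewrite !hornerE; have := NP _ mN a aT; have := NP _ nN a aT.
  by rewrite !ler_norml => /andP[? ?] /andP[? ?]; apply/andP; split; lra.
by exists S; apply/is_fun_calcP; exists q.
Qed.

(** Two approximating sequences are eventually close on the spectrum, so by [op_horner_bound] their
    operators are close in norm. *)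
Lemma is_fun_calc_uniq f S S' :
  is_fun_calc f T S -> is_fun_calc f T S' -> S = S'.
Proof.
move=> /is_fun_calcP[q [qf qS]] /is_fun_calcP[r [rf rS']].
apply: op_cvg_uniq qS _; apply/op_cvgP => e e0.
have e2 : 0 < e / 2 by rewrite divr_gt0.
have e4 : 0 < e / 2 / 2 by rewrite divr_gt0.
have [N1 N1P] := qf _ e4; have [N2 N2P] := rf _ e4.
have /op_cvgP/(_ _ e2)[N3 N3P] := rS'.
exists (maxn N1 (maxn N2 N3)) => n; rewrite !geq_max.
move=> /and3P[/N1P h1 /N2P h2 /N3P h3] x.
rewrite -(subrK (op_horner (r n) T x) (op_horner (q n) T x)) -addrA.
apply: le_trans (rnormD _ _) _; rewrite (splitr e) mulrDl lerD//.
rewrite -opBE -op_hornerB.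
apply: op_horner_bound => // [|a aT]; first exact: ltW.
rewrite !hornerE; have := h1 a aT; have := h2 a aT.
by rewrite !ler_norml => /andP[? ?] /andP[? ?]; apply/andP; split; lra.
Qed.

Lemma is_fun_calcM f g S S' M :
  (forall a, spec a -> `|f a| <= M) -> (forall a, spec a -> `|g a| <= M) ->
  is_fun_calc f T S -> is_fun_calc g T S' ->
  is_fun_calc (fun a => f a * g a) T (S * S').
Proof.
move=> fM gM /is_fun_calcP[q [qf qS]] /is_fun_calcP[r [rg rS']].
apply/is_fun_calcP; exists (fun n => q n * r n); split; last first.
  have := op_cvgM qS rS'; congr op_cvg.
  by apply/funext => n; rewrite op_hornerM.
move=> e e0; pose K := `|M| + 1.
(* K bounds f and, on the spectrum, also the polynomials r n once they are within 1 of g. *)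
have K0 : 0 < K by rewrite ltr_wpDl.
have MK : M <= K by rewrite (le_trans (ler_norm _))// lerDl.
have eK : 0 < e / 2 / K by rewrite !divr_gt0.
have [N1 N1P] := qf _ eK; have [N2 N2P] := rg _ eK.
have [N3 N3P] := rg _ ltr01.
exists (maxn N1 (maxn N2 N3)) => n; rewrite !geq_max.
move=> /and3P[/N1P h1 /N2P h2 /N3P h3] a aT.
have -> : (q n * r n).[a] - f a * g a =
    ((q n).[a] - f a) * (r n).[a] + f a * ((r n).[a] - g a).
  by rewrite hornerM; ring.
apply: le_trans (ler_normD _ _) _; rewrite !normrM (splitr e).
have rK : `|(r n).[a]| <= K.
  rewrite -(subrK (g a) (r n).[a]) (le_trans (ler_normD _ _))// /K addrC lerD//.
    by rewrite (le_trans (gM _ _))// ler_norm.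
  exact: h3.
apply: lerD; rewrite -[e / 2](divfK (lt0r_neq0 K0)).
  by apply: ler_pM => //; exact: h1.
rewrite [leRHS]mulrC; apply: ler_pM => //; last exact: h2.
by rewrite (le_trans (fM _ _)).
Qed.

Lemma is_fun_calc_ext f g S : (forall a, spec a -> f a = g a) ->
  is_fun_calc f T S -> is_fun_calc g T S.
Proof.
move=> fg /is_fun_calcP[q [qf qS]]; apply/is_fun_calcP.
exists q; split=> // e e0.
by have [N NP] := qf e e0; exists N => n nN a aT; rewrite -fg//; exact: NP.
Qed.

Lemma is_fun_calc_id : is_fun_calc id T T.
Proof.
apply/is_fun_calcP; exists (fun=> 'X); split=> [e e0|].
  by exists 0 => n _ a _; rewrite hornerX subrr normr0 ltW.
by apply/op_cvgP => e e0; exists 0 => n _ x;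
  rewrite op_hornerX subrr rnorm0 mulr_ge0 ?rnorm_ge0 ?ltW.
Qed.

Lemma is_fun_calc_symmetric f S : is_fun_calc f T S -> symmetric_op S.
Proof.
move=> /is_fun_calcP[q [_ qS]] x y; apply: rinner_adjoint => {}x.
apply/eqP; rewrite -subr_eq0 -normr_eq0 eq_le normr_ge0 andbT.
apply/ler_addgt0Pl => e e0; rewrite addr0.
pose K := rnorm x + rnorm y + 1.
have K0 : 0 < K by rewrite ltr_wpDl ?addr_ge0 ?rnorm_ge0.
have d0 : 0 < e / K / 2 by rewrite !divr_gt0.
have [N NP] := op_cvg_pointwise x qS d0.
have [N' N'P] := op_cvg_pointwise y qS d0.
have := NP _ (leq_maxl N N'); have := N'P _ (leq_maxr N N').
set Q := op_horner _ T => hy hx.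
have sQ : symmetric_op Q by exact: symmetric_op_horner.
have -> : rinner (S x) y - rinner x (S y) =
    rinner x (Q y - S y) - rinner (Q x - S x) y.
  by rewrite rinnerBl rinnerBr (symmetric_rinner sQ); ring.
apply: le_trans (ler_normB _ _) _.
have h1 := le_trans (rinner_le _ _) (ler_wpM2l (rnorm_ge0 x) hy).
have h2 := le_trans (rinner_le _ _) (ler_wpM2r (rnorm_ge0 y) hx).
apply: le_trans (lerD h1 h2) _.
have -> : rnorm x * (e / K / 2) + e / K / 2 * rnorm y = e / 2 * ((K - 1) / K).
  by rewrite /K; field; rewrite lt0r_neq0.
have KK : (K - 1) / K <= 1 by rewrite ler_pdivrMr// mul1r gerDl lerN10.
have e2 : 0 < e / 2 by rewrite divr_gt0.
by rewrite (le_trans (ler_wpM2l (ltW e2) KK))// mulr1; lra.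
Qed.

(** A nonzero kernel vector puts 0 in the spectrum, and q(T) x = q(0) x tends to f(0) x = 0. *)
Lemma is_fun_calc_ker f S x :
  f 0 = 0 -> is_fun_calc f T S -> T x = 0 -> S x = 0.
Proof.
move=> f0 /is_fun_calcP[q [qf qS]] Tx0.
have [->|x0] := eqVneq x 0; first by rewrite linear0.
have s0 : spec 0.
  move=> [U [UT _]]; move: x0; have := congr1 (fun A : 'B(H) => A x) UT.
  by rewrite scale0r subr0 opME Tx0 linear0 op1E => <-; rewrite eqxx.
have qx q' : op_horner q' T x = (q'.[0])%:C *: x.
  elim/poly_ind: q' => [|p c _].
    by rewrite -polyC0 op_hornerC hornerC.
  rewrite hornerMXaddC mulr0 add0r -[c%:P]opprK op_hornerB opBE -polyCN.
  rewrite op_hornerC op_hornerM op_hornerX opME Tx0 linear0 sub0r opZE op1E.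
  by rewrite rmorphN scaleNr opprK.
apply: rnorm_le0 => e e0.
have x1 : 0 < rnorm x + 1 by rewrite ltr_wpDl ?rnorm_ge0.
have e2 : 0 < e / 2 by rewrite divr_gt0.
have [N NP] := qf _ (divr_gt0 e2 x1); have [N' N'P] := op_cvg_pointwise x qS e2.
have := NP _ (leq_maxl N N') 0 s0; have := N'P _ (leq_maxr N N').
rewrite f0 subr0 qx; set b := (q _).[0] => h1 h2.
have := rnormD (S x - b%:C *: x) (b%:C *: x); rewrite subrK rnormB rnormZ => h3.
have : `|b| * rnorm x <= e / 2.
  apply: le_trans (ler_wpM2r (rnorm_ge0 x) h2) _.
  by rewrite mulrAC ler_pdivrMr// ler_pM2l// lerDl.
lra.
Qed.

End FunctionalCalculus.

(** * Powers of positive operators and the modulus *)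

Section PositivePowers.
Variables (R : realType) (H : hilbertType R).
Implicit Types (x y : H) (S T C : 'B(H)) (r s : R).

Definition positive_op T := symmetric_op T /\ forall x, 0 <= rinner (T x) x.

Lemma positive_powP T s : positive_op T -> 0 <= s <= 1 ->
  is_fun_calc (fun a => a `^ s) T (op_pow T s).
Proof.
move=> [sT T0] s01; have [M M0 TM] := op_rbounded T.
have M1 : 0 < M + 1 by rewrite ltr_wpDl.
have [e e0|S SP] := @is_fun_calc_exists _ _ _ sT (fun a => a `^ s); last first.
  have : [set S | is_fun_calc (fun a => a `^ s) T S] S := SP.
  by move=> /(xgetI 0).
have [q qP] := powR_poly_approx s01 M1 e0; exists q => a aT; apply: qP.
have /andP[-> aM] := positive_spectrum sT T0 TM aT.
by rewrite (le_trans aM)// lerDl.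
Qed.

Lemma op_pow_symmetric T s : positive_op T -> 0 <= s <= 1 ->
  symmetric_op (op_pow T s).
Proof.
by move=> T0 s01; apply: is_fun_calc_symmetric (positive_powP T0 s01); case: T0.
Qed.

(** One exponent may vanish, as for p = 1 in the theorem: with 0^0 = 1 the scalar law still holds at
    0, because r + s > 0. *)
Lemma op_powD T r s : positive_op T -> 0 <= r -> 0 <= s -> 0 < r + s <= 1 ->
  op_pow T r * op_pow T s = op_pow T (r + s).
Proof.
move=> T0 r0 s0 /andP[rs0 rs1]; have [sT Tp] := T0.
have powT (u : R) : 0 <= u <= 1 -> is_fun_calc (fun a => a `^ u) T (op_pow T u).
  exact: positive_powP.
have [M M0 TM] := op_rbounded T.
have bound (u : R) : 0 <= u <= 1 ->
    forall a : R, spectrum T a%:C -> `|a `^ u| <= M + 1.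
  move=> /andP[u0 u1] a /(positive_spectrum sT Tp TM)/andP[a0 aM].
  rewrite ger0_norm ?powR_ge0//; have [a1|/ltW a1] := lerP a 1.
    apply: le_trans (_ : 1 <= _); last by rewrite lerDr.
    by have := ge0_ler_powR u0 a0 ler01 a1; rewrite powR1.
  by rewrite (le_trans (ler1_powR a1 u1))// (le_trans aM)// lerDl.
have r01 : 0 <= r <= 1 by rewrite r0 (le_trans _ rs1)// lerDl.
have s01 : 0 <= s <= 1 by rewrite s0 (le_trans _ rs1)// lerDr.
apply: (is_fun_calc_uniq sT _ (powT _ _)); last by rewrite ltW.
have := is_fun_calcM (bound _ r01) (bound _ s01) (powT _ r01) (powT _ s01).
by apply: is_fun_calc_ext => a _; rewrite powRD// gt_eqF.
Qed.

Lemma op_pow1 T : positive_op T -> op_pow T 1 = T.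
Proof.
move=> T0; have [sT Tp] := T0; have [M M0 TM] := op_rbounded T.
have := positive_powP T0 (_ : 0 <= 1 <= 1); rewrite ler01 lexx => /(_ isT) h.
apply: (is_fun_calc_uniq sT _ (is_fun_calc_id T)).
apply: is_fun_calc_ext h => a /(positive_spectrum sT Tp TM)/andP[a0 _].
exact: powRr1.
Qed.

(** T^s is the square of the symmetric operator T^(s/2). *)
Lemma op_pow_positive T s :
  positive_op T -> 0 < s <= 1 -> positive_op (op_pow T s).
Proof.
move=> T0 /andP[s0 s1]; split=> [|x].
  by apply: op_pow_symmetric => //; rewrite ltW.
have s2 : 0 <= s / 2 by rewrite divr_ge0 ?ltW.
have sE : s / 2 + s / 2 = s by rewrite -splitr.
rewrite -sE -op_powD ?sE ?s0// opME.
have sS : symmetric_op (op_pow T (s / 2)).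
  by apply: op_pow_symmetric => //; rewrite s2/=; lra.
by rewrite (symmetric_rinner sS) -rnorm_sqr sqr_ge0.
Qed.

Lemma op_pow_ker T s x : positive_op T -> 0 < s <= 1 -> T x = 0 ->
  op_pow T s x = 0.
Proof.
move=> T0 /andP[s0 s1] Tx0; have s01 : 0 <= s <= 1 by rewrite ltW.
apply: (is_fun_calc_ker _ (positive_powP T0 s01) Tx0).
by rewrite powR0 ?gt_eqF.
Qed.

Lemma adjointM_positive C : positive_op (adjoint C * C).
Proof.
split=> [|x]; first exact: symmetric_adjointM.
by rewrite rinner_adjointM sqr_ge0.
Qed.

Lemma op_abs_positive C : positive_op (op_abs C).
Proof. by apply: op_pow_positive (adjointM_positive C) _; lra. Qed.

Lemma op_abs_sqr C : op_abs C ^+ 2 = adjoint C * C.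
Proof.
have C0 := adjointM_positive C.
have half : 2^-1 + 2^-1 = 1 :> R by lra.
by rewrite expr2 op_powD ?half ?op_pow1 ?invr_ge0// ltr01 lexx.
Qed.

Lemma rinner_op_abs_sqr C x : rinner ((op_abs C ^+ 2) x) x = rnorm (C x) ^+ 2.
Proof. by rewrite op_abs_sqr rinner_adjointM. Qed.

Lemma rinner_op_abs_sqrD (a b : R) C C' x :
  rinner ((a%:C *: op_abs C ^+ 2 + b%:C *: op_abs C' ^+ 2) x) x =
  a * rnorm (C x) ^+ 2 + b * rnorm (C' x) ^+ 2.
Proof. by rewrite opDE !opZE rinnerDl !rinnerZl !rinner_op_abs_sqr. Qed.

Lemma op_abs_sqr_symmetric C : symmetric_op (op_abs C ^+ 2).
Proof. by rewrite op_abs_sqr; exact: symmetric_adjointM. Qed.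

Lemma rnorm_op_abs C x : rnorm (op_abs C x) = rnorm (C x).
Proof.
have [sC _] := op_abs_positive C.
apply/eqP; rewrite -(eqrXn2 (n := 2)) ?rnorm_ge0// -(rinner_op_abs_sqr C).
by rewrite rnorm_sqr expr2 opME (symmetric_rinner sC (op_abs C x)).
Qed.

(** Polarization at x and y = S x - T x yields <y, y> = 0. *)
Lemma symmetric_ext S T : symmetric_op S -> symmetric_op T ->
  (forall x, rinner (S x) x = rinner (T x) x) -> S = T.
Proof.
move=> sS sT ST; apply: opP => x; apply/eqP; rewrite -subr_eq0 -rnorm_eq0.
rewrite -sqrf_eq0 rnorm_sqr; set y := S x - T x.
have polar Q z : symmetric_op Q -> rinner (Q (x + z)) (x + z) =
    rinner (Q x) x + 2 * rinner (Q x) z + rinner (Q z) z.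
  move=> sQ; have -> : Q (x + z) = Q x + Q z by rewrite linearD.
  rewrite rinnerDl !rinnerDr (symmetric_rinner sQ z x).
  by rewrite (rinnerC z); ring.
have -> : rinner y y = rinner (S x) y - rinner (T x) y by rewrite -rinnerBl.
have := ST (x + y); rewrite !polar// (ST x) (ST y) => /addIr/addrI e.
by apply/eqP; lra.
Qed.

Lemma inner_symmetric T x :
  symmetric_op T -> inner (T x) x = (rinner (T x) x)%:C.
Proof.
move=> sT; have := inner_conj (T x) x; rewrite -sT /rinner.
by case: (inner _ _) => a b [] /= ?; congr (_ +i* _); lra.
Qed.

Lemma symmetric_kerMB S T C y : symmetric_op S -> symmetric_op T ->
  S y = 0 -> T y = 0 -> forall x, inner ((S * C - T) x) y = 0.
Proof.
move=> sS sT Sy Ty x.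
by rewrite opBE opME innerDl innerNl sS sT Sy Ty !inner0r subr0.
Qed.

Lemma polar_difference (A B U V P P' Q a b : 'B(H)) :
  A = U * a -> B = V * b -> P * P' = a ->
  (U * P - V * Q) * P' = (A - B) - V * (Q * P' - b).
Proof.
move=> -> -> PP'; rewrite mulrBl -mulrA PP' mulrBr opprB addrA subrK.
by rewrite mulrA.
Qed.

End PositivePowers.

(** * The weighted Young identity and the operator inequality *)

Lemma young_defect (R : realType) (H : hilbertType R) (t : R) (u v : H) :
  t != 0 ->
  (1 + t) * rnorm u ^+ 2 + (1 + 1 / t) * rnorm v ^+ 2 - rnorm (u - v) ^+ 2 =
  t^-1 * rnorm (t%:C *: u + v) ^+ 2.
Proof.
move=> t0; rewrite !rnorm_sqr rinnerBl !rinnerBr !rinnerDl !rinnerDr.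
by rewrite !rinnerZl !rinnerZr (rinnerC v u); field.
Qed.

Theorem theorem2p2 (R : realType) (H : hilbertType R) (A B U V : 'B(H))
    (t p : R) :
  polar_decomposition A U -> polar_decomposition B V ->
  0 < t -> 0 < p <= 1 ->
  let lhs :=
    op_abs ((U * op_pow (op_abs A) p - V * op_pow (op_abs B) p)
              * op_pow (op_abs A) (1 - p)) ^+ 2 in
  let rhs :=
    (1 + t)%:C *: op_abs (A - B) ^+ 2
    + (1 + 1 / t)%:C *:
        op_abs (op_pow (op_abs B) p * op_pow (op_abs A) (1 - p) - op_abs B)
          ^+ 2 in
  lhs <=op rhs /\
  (lhs = rhs <->
   t%:C *: (A - B)
   + V * (op_pow (op_abs B) p * op_pow (op_abs A) (1 - p) - op_abs B) = 0).
Proof.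
move=> [AE _ _] [BE Viso kerV] t0 p01; have /andP[p0 p1] := p01.
set F := op_pow (op_abs B) p * op_pow (op_abs A) (1 - p) - op_abs B.
move=> lhs rhs.
have A0 := op_abs_positive A; have B0 := op_abs_positive B.
have q0 : 0 <= 1 - p by rewrite subr_ge0.
(* Vectors of ker V = ker B are killed by |B| and |B|^p, hence orthogonal to the range of F; there V
   is isometric. *)
have VF x : rnorm (V (F x)) = rnorm (F x).
  rewrite /rnorm Viso// => y; rewrite kerV => By0.
  have aBy : op_abs B y = 0.
    by apply/eqP; rewrite -rnorm_eq0 rnorm_op_abs By0 rnorm0.
  have p01' : 0 <= p <= 1 by rewrite ltW.
  have pBy := op_pow_ker B0 p01 aBy.
  have [sB _] := B0; have sBp := op_pow_symmetric B0 p01'.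
  exact (symmetric_kerMB (op_pow (op_abs A) (1 - p)) sBp sB pBy aBy x).
have AqE : op_pow (op_abs A) p * op_pow (op_abs A) (1 - p) = op_abs A.
  have pq : p + (1 - p) = 1 by rewrite addrC subrK.
  have := op_powD A0 (ltW p0) q0; rewrite pq ltr01 lexx => /(_ isT) ->.
  exact: op_pow1.
have XE := polar_difference (op_pow (op_abs B) p) AE BE AqE.
have sl : symmetric_op lhs := op_abs_sqr_symmetric _.
have sr : symmetric_op rhs.
  by apply: symmetric_opD; apply/symmetric_opZ/op_abs_sqr_symmetric.
(* The nonnegative right side gives the inequality, and its vanishing for all x is the equality
   case. *)
have defect x : rinner (rhs x) x - rinner (lhs x) x =
    t^-1 * rnorm ((t%:C *: (A - B) + V * F) x) ^+ 2.
  rewrite rinner_op_abs_sqrD rinner_op_abs_sqr XE -VF.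
  exact: young_defect (lt0r_neq0 t0).
split=> [x|].
  rewrite !inner_symmetric// lecR -subr_ge0 defect mulr_ge0 ?sqr_ge0//.
  by rewrite invr_ge0 ltW.
split=> [lr|TE0].
  apply: opP => x; apply/eqP; rewrite -rnorm_eq0 -sqrf_eq0.
  have := defect x; rewrite lr subrr => /esym/eqP.
  by rewrite mulf_eq0 invr_eq0 gt_eqF.
apply: symmetric_ext => // x; apply/esym/eqP.
by rewrite -subr_eq0 defect TE0 rnorm0 expr0n mulr0.
Qed.
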